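(* Consider the dynamical system for $(x,y,\lambda)$ given in the context, with parameters $\varepsilon\in\{+1,-1\}$, $\xi$, $w_m$ and function $z(\lambda)$. Suppose $\lambda_4^*\in I$ satisfies $z(\lambda_4^* )=0$. Then $(x,y,\lambda)=(0,0,\lambda_4^* )$ is a critical point of the system with $w_{\mathrm{eff}}=w_m$, and the eigenvalues (possibly complex) of the linearization matrix at it are $$l_{1}=-\tfrac34\Big((1-w_m)+\sqrt{(1-w_m)^2-\tfrac{16}{3}\xi(1-3w_m)}\Big),\qquad l_2=\tfrac32(1+w_m),$$ $$l_{3}=-\tfrac34\Big((1-w_m)-\sqrt{(1-w_m)^2-\tfrac{16}{3}\xi(1-3w_m)}\Big).$$ In particular, for every value of $\xi$, the linearization matrix is degenerate (has a zero eigenvalue) if $w_m=-1$ (where $l_2=0$) and if $w_m=\frac13$ (where $l_3=0$).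
   Context: Let $\varepsilon\in\{+1,-1\}$ ($+1$ canonical, $-1$ phantom scalar field), $\xi,w_m\in\mathbb{R}$, and let $z:I\to\mathbb{R}$ be a smooth function on an open interval $I$ with nowhere vanishing derivative $z'(\lambda)=\frac{dz}{d\lambda}$ (equivalently $z'(\lambda)=-1/(\lambda^2(\Gamma(\lambda)-1))$ for the function $\Gamma=U''U/U'^2$ determined by the scalar field potential $U$). Put $$D=1-6\varepsilon\xi(1-6\xi)z(\lambda)^2,$$ $$B=-\tfrac43-2\xi\lambda y^2z(\lambda)+\varepsilon(1-6\xi)(1-w_m)x^2+2\varepsilon\xi(1-3w_m)(x+z(\lambda))^2+(1+w_m)(1-y^2).$$ The dynamical system on $\mathbb{R}^2\times I$ is $$\frac{dx}{d\tau}=-\left(x-\tfrac{\varepsilon}{2}\lambda y^2\right)D+\tfrac32\left(x+6\xi z(\lambda)\right)B,\qquad \frac{dy}{d\tau}=y\left(2-\tfrac12\lambda x\right)D+\tfrac32\,yB,\qquad \frac{d\lambda}{d\tau}=\frac{x\,D}{z'(\lambda)}.$$ The effective equation of state parameter is $$w_{\mathrm{eff}}=\frac1D\Big[-1+\varepsilon(1-6\xi)(1-w_m)x^2+2\varepsilon\xi(1-3w_m)(x+z)^2+(1+w_m)(1-y^2)-2\varepsilon\xi(1-6\xi)z^2-2\xi y^2\lambda z\Big],\quad z=z(\lambda).$$ For a negative radicand the square root denotes a complex square root. *)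

(* Defs.v *)
From mathcomp Require Import all_boot all_order all_algebra.
From mathcomp Require Import all_classical all_reals all_analysis.
From mathcomp.real_closed Require Export complex.
Set Implicit Arguments.
Unset Strict Implicit.
Unset Printing Implicit Defensive.
Import Order.TTheory GRing.Theory Num.Theory.
Import numFieldNormedType.Exports.
Local Open Scope ring_scope.
Local Open Scope classical_set_scope.

Definition open_interval (R : realType) (I : set R) : Prop :=
  open I /\ is_interval I.

(* Functions on [I] are represented by total functions whose values outside of
   [I] are arbitrary; as [I] is open, derivatives at points of [I] only depend
   on the restriction to [I]. *)
Definition smooth_on (R : realType) (I : set R) (z : R -> R) : Prop :=
  forall (n : nat) (t : R), I t -> derivable (z^`(n)) t 1.

Definition state (R : realType) (x y lam : R) : 'rV[R]_3 :=
  \row_(i < 3) [:: x; y; lam]`_i.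

Definition xc (R : realType) (p : 'rV[R]_3) : R := p ord0 (inord 0).
Definition yc (R : realType) (p : 'rV[R]_3) : R := p ord0 (inord 1).
Definition lamc (R : realType) (p : 'rV[R]_3) : R := p ord0 (inord 2).

Definition phase_space (R : realType) (I : set R) : set 'rV[R]_3 :=
  [set p | I (lamc p)].

Section System.
Variables (R : realType) (eps xi wm : R) (z : R -> R).
Implicit Types x y lam : R.

Definition Dfun lam : R := 1 - 6 * eps * xi * (1 - 6 * xi) * z lam ^+ 2.

Definition Bfun x y lam : R :=
  - (4 / 3) - 2 * xi * lam * y ^+ 2 * z lam
  + eps * (1 - 6 * xi) * (1 - wm) * x ^+ 2
  + 2 * eps * xi * (1 - 3 * wm) * (x + z lam) ^+ 2
  + (1 + wm) * (1 - y ^+ 2).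

Definition dx x y lam : R :=
  - (x - eps / 2 * lam * y ^+ 2) * Dfun lam
  + 3 / 2 * (x + 6 * xi * z lam) * Bfun x y lam.

Definition dy x y lam : R :=
  y * (2 - 1 / 2 * lam * x) * Dfun lam + 3 / 2 * y * Bfun x y lam.

Definition dlam x y lam : R := x * Dfun lam / derive1 z lam.

Definition vector_field (p : 'rV[R]_3) : 'rV[R]_3 :=
  let x := xc p in let y := yc p in let lam := lamc p in
  state (dx x y lam) (dy x y lam) (dlam x y lam).

Definition w_eff (p : 'rV[R]_3) : R :=
  let x := xc p in let y := yc p in let lam := lamc p in
  1 / Dfun lam *
  (- 1 + eps * (1 - 6 * xi) * (1 - wm) * x ^+ 2
   + 2 * eps * xi * (1 - 3 * wm) * (x + z lam) ^+ 2
   + (1 + wm) * (1 - y ^+ 2)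
   - 2 * eps * xi * (1 - 6 * xi) * z lam ^+ 2
   - 2 * xi * y ^+ 2 * lam * z lam).

End System.

Definition critical_point (R : realType) (I : set R)
    (F : 'rV[R]_3 -> 'rV[R]_3) (p : 'rV[R]_3) : Prop :=
  phase_space I p /\ F p = 0.

(* The library Jacobian ['J F p] acts on row vectors on the right, that is, its
   entry (i, j) is the i-th partial derivative of the j-th component;
   [eigenvalue] uses the same convention. *)
Definition linearization (R : realType) (F : 'rV[R]_3 -> 'rV[R]_3)
    (p : 'rV[R]_3) : 'M[R]_3 := 'J F p.

Definition degenerate (R : realType) (A : 'M[R]_3) : Prop := eigenvalue A 0.

(* [s] lists the complex eigenvalues of [A]: the members of [s] are exactly the
   eigenvalues, each repeated according to its algebraic multiplicity. *)
Definition eigenvalues_are (R : realType) (A : 'M[R]_3) (s : seq R[i]) : Prop :=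
  let AC := map_mx (real_complex R) A in
  (forall l : R[i], eigenvalue AC l = (l \in s)) /\
  char_poly AC = \prod_(l <- s) ('X - l%:P).

(* Main.v *)
From HB Require Import structures.
Require Import Defs.
From mathcomp Require Import all_boot all_order all_algebra.
From mathcomp Require Import all_classical all_reals all_analysis.
From mathcomp.real_closed Require Import complex.
From mathcomp Require Import ring lra.
Set Implicit Arguments.
Unset Strict Implicit.
Unset Printing Implicit Defensive.
Import Order.TTheory GRing.Theory Num.Theory.
Import numFieldNormedType.Exports.
Local Open Scope ring_scope.
Local Open Scope classical_set_scope.
Local Open Scope complex_scope.

(** Where [x], [y] and [z] vanish, [D] and [B] are constant to first order, with
    values [1] and [wm - 1/3]. Hence [y] decouples in the linearization,
    contributing [l2], while [x] and [lambda] form a 2x2 block of trace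
    [-3/2 (1 - wm)] and determinant [3 xi (1 - 3 wm)], in which [z'] cancels. *)

Section PointwiseDifferentials.
Variables (R : realType) (V : normedModType R).
Implicit Types (f g df dg : V -> R) (x : V).

(** This and the next rules are phrased on pointwise expressions, so that differentiating an
    explicit formula yields an identity within reach of [ring] or [field]. *)
Lemma is_diff_const (c : R) x : is_diff x (fun _ => c) (fun _ => 0).
Proof. exact: is_diff_cst. Qed.

Lemma is_diff_add f g df dg x : is_diff x f df -> is_diff x g dg ->
  is_diff x (fun q => f q + g q) (fun v => df v + dg v).
Proof. by move=> dfx dgx; exact: is_diffD. Qed.

Lemma is_diff_opp f df x : is_diff x f df ->
  is_diff x (fun q => - f q) (fun v => - df v).
Proof. by move=> dfx; exact: is_diffN. Qed.

Lemma is_diff_mul f g df dg x : is_diff x f df -> is_diff x g dg ->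
  is_diff x (fun q => f q * g q) (fun v => f x * dg v + g x * df v).
Proof. by move=> dfx dgx; exact: is_diffM. Qed.

Lemma is_diff_sqr f df x : is_diff x f df ->
  is_diff x (fun q => f q ^+ 2) (fun v => 2 * f x * df v).
Proof.
move=> dfx; apply: (is_diff_eq (is_diff_mul dfx dfx)).
by apply/funext => v; ring.
Qed.

Lemma is_diff_inv f df x : is_diff x f df -> f x != 0 ->
  is_diff x (fun q => (f q)^-1) (fun v => - (f x) ^- 2 * df v).
Proof.
move=> dfx fx0; apply: DiffDef; first by apply: differentiableV.
by rewrite diffV// diff_val.
Qed.

Lemma is_diff_comp1 (h : R -> R) f df x : is_diff x f df ->
  derivable h (f x) 1 ->
  is_diff x (fun q => h (f q)) (fun v => derive1 h (f x) * df v).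
Proof.
move=> dfx dh.
have dh' : is_diff (f x) h ( *:%R^~ (derive1 h (f x))).
  by apply: DiffDef; [exact/derivable1_diffP|rewrite deriv1E].
apply: (is_diff_eq (is_diff_comp dfx dh')).
by apply/funext => v; rewrite /= mulrC.
Qed.

End PointwiseDifferentials.

Lemma is_diff_coord (R : realType) (n : nat) (p : 'rV[R]_n) (j : 'I_n) :
  is_diff p (fun q : 'rV[R]_n => q ord0 j : R) (fun v => v ord0 j).
Proof.
pose coord (q : 'rV[R]_n) : R := q ord0 j.
have coord_lin : linear coord by move=> a u v; rewrite /coord !mxE.
(* [diff_lin] expects a bundled linear map, hence the structure packed by hand. *)
pose coordM := GRing.isLinear.Build _ _ _ _ _ coord_lin.
pose coordL : {linear _ -> _} := HB.pack coord coordM.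
apply: DiffDef; first exact: differentiable_coord.
by rewrite -/coord -[coord]/(coordL : _ -> _) diff_lin //; exact: coord_continuous.
Qed.

(** [F] is the sum of its components times the basis rows, hence differentiable; composing with each
    coordinate projection then identifies the differential. *)
Lemma is_diff_row (R : realType) (V : normedModType R) (n : nat)
    (F : V -> 'rV[R]_n) (dF : 'I_n -> V -> R) (x : V) :
  (forall j, is_diff x (fun q => F q ord0 j) (dF j)) ->
  is_diff x F (fun v => \row_j dF j v).
Proof.
move=> dFx.
have dF' : differentiable F x.
  have -> : F = \sum_j (fun q => F q ord0 j *: delta_mx ord0 j).
    by apply/funext => q; rewrite fct_sumE [LHS]row_sum_delta.
  apply: differentiable_sum => j.
  by have [] := is_diff_comp (dFx j)
    (is_diff_scalel (F x ord0 j) (delta_mx ord0 j : 'rV[R]_n)).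
apply: DiffDef => //; apply/funext => v; apply/rowP => j; rewrite mxE.
have [_ <-] := dFx j.
have [dc dcE] := is_diff_coord (F x) j.
have /(congr1 (@^~ v)) := diff_comp dF' dc.
by rewrite dcE.
Qed.

Lemma det_mx3 (R : comNzRingType) (A : 'M[R]_3) :
  let a i j := A (inord i) (inord j) in
  \det A = a 0 0 * (a 1 1 * a 2 2 - a 1 2 * a 2 1)
         - a 0 1 * (a 1 0 * a 2 2 - a 1 2 * a 2 0)
         + a 0 2 * (a 1 0 * a 2 1 - a 1 1 * a 2 0).
Proof.
move=> a.
(* Indexing by naturals lets the lifted indices of the cofactors compute to literals. *)
have AE (i j : 'I_3) : A i j = a i j by rewrite /a !inord_val.
rewrite (expand_det_row _ ord0) !big_ord_recl big_ord0 /cofactor.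
rewrite !(expand_det_row _ ord0) !big_ord_recl !big_ord0 /cofactor.
rewrite !det_mx11 !mxE !AE /= /bump /=.
rewrite !(exprS, expr0, add0n, addn0, leq0n, addnS) /=.
ring.
Qed.

Lemma state_coords (R : realType) (x y lam : R) (p := state x y lam) :
  [/\ xc p = x, yc p = y & lamc p = lam].
Proof. by rewrite /xc /yc /lamc !mxE !inordK. Qed.

(* [notypeclasses]: [apply] would let instance search discharge the premises
   with the library's function-level differentials instead of the pointwise
   ones, leaving an equation that [ring] cannot read. *)
Ltac differentiate := repeat first
  [ eassumption
  | notypeclasses refine (is_diff_const _ _)
  | notypeclasses refine (is_diff_sqr _)
  | notypeclasses refine (is_diff_opp _)
  | notypeclasses refine (is_diff_add _ _)
  | notypeclasses refine (is_diff_mul _ _) ].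

Lemma is_diff_vector_field (R : realType) (eps xi wm lam0 : R) (z : R -> R) :
  z lam0 = 0 -> derivable z lam0 1 -> derivable (derive1 z) lam0 1 ->
  derive1 z lam0 != 0 ->
  is_diff (state 0 0 lam0) (vector_field eps xi wm z) (fun v =>
    state (- (3 / 2) * (1 - wm) * xc v
             - 3 * xi * (1 - 3 * wm) * derive1 z lam0 * lamc v)
          (3 / 2 * (1 + wm) * yc v)
          (xc v / derive1 z lam0)).
Proof.
move=> z0 dz dz' z'0; set p := state _ _ _.
have [px py pl] : [/\ xc p = 0, yc p = 0 & lamc p = lam0] by exact: state_coords.
have dX : is_diff p (@xc R) (@xc R) by exact: is_diff_coord.
have dY : is_diff p (@yc R) (@yc R) by exact: is_diff_coord.
have dL : is_diff p (@lamc R) (@lamc R) by exact: is_diff_coord.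
have dZ : is_diff p (fun q => z (lamc q)) (fun v => derive1 z lam0 * lamc v).
  by rewrite -[in derive1 z lam0]pl; apply: is_diff_comp1; rewrite ?pl.
have dZ' : is_diff p (fun q => derive1 z (lamc q))
    (fun v => derive1 (derive1 z) lam0 * lamc v).
  by rewrite -[in derive1 _ lam0]pl; apply: is_diff_comp1; rewrite ?pl.
(* Every nonconstant term of [D] and of [B] is at least quadratic in [x], [y] and [z], all zero at
   [p]. *)
have dD : is_diff p (fun q => Dfun eps xi z (lamc q)) (fun=> 0).
  rewrite /Dfun; notypeclasses refine (is_diff_eq _ _); first differentiate.
  by apply/funext => v /=; rewrite pl z0; ring.
have dB : is_diff p (fun q => Bfun eps xi wm z (xc q) (yc q) (lamc q))
    (fun=> 0).
  rewrite /Bfun; notypeclasses refine (is_diff_eq _ _); first differentiate.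
  by apply/funext => v /=; rewrite px py pl z0; ring.
have dZV := is_diff_inv dZ'; rewrite pl in dZV; have {}dZV := dZV z'0.
have Dp : Dfun eps xi z lam0 = 1 by rewrite /Dfun z0; ring.
have Bp : Bfun eps xi wm z 0 0 lam0 = wm - 1 / 3 by rewrite /Bfun z0; field.
(* With [D = 1] and [B = wm - 1/3], the coefficients are [-1 + 3/2 B = -3/2 (1 - wm)] and
   [9 xi B = -3 xi (1 - 3 wm)]; for [y] below, [2 + 3/2 B = 3/2 (1 + wm)]. *)
have dDx : is_diff p (fun q => dx eps xi wm z (xc q) (yc q) (lamc q))
    (fun v => - (3 / 2) * (1 - wm) * xc v
              - 3 * xi * (1 - 3 * wm) * derive1 z lam0 * lamc v).
  rewrite /dx; notypeclasses refine (is_diff_eq _ _); first differentiate.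
  by apply/funext => v /=; rewrite px py pl Dp Bp z0; field.
have dDy : is_diff p (fun q => dy eps xi wm z (xc q) (yc q) (lamc q))
    (fun v => 3 / 2 * (1 + wm) * yc v).
  rewrite /dy; notypeclasses refine (is_diff_eq _ _); first differentiate.
  by apply/funext => v /=; rewrite px py pl Dp Bp; field.
(* The quotient rule brings in [z''], but multiplied by [x D], which vanishes at [p]. *)
have dDl : is_diff p (fun q => dlam eps xi z (xc q) (yc q) (lamc q))
    (fun v => xc v / derive1 z lam0).
  rewrite /dlam; notypeclasses refine (is_diff_eq _ _); first differentiate.
  by apply/funext => v /=; rewrite px pl Dp; field.
have FE q j : vector_field eps xi wm z q ord0 j =
    [:: dx eps xi wm z (xc q) (yc q) (lamc q);
        dy eps xi wm z (xc q) (yc q) (lamc q);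
        dlam eps xi z (xc q) (yc q) (lamc q)]`_j by rewrite mxE.
by apply: is_diff_row => -[[|[|[|//]]] ltj]; rewrite (funext (FE ^~ _)).
Qed.

(** The middle coordinate splits off the factor of [b]; the outer 2x2 block has trace [a] and
    determinant [- c d]. *)
Lemma char_poly_decoupled_mx3 (R : comNzRingType) (a b c d : R)
    (A : 'M[R]_3) :
  (forall i j : 'I_3, A i j =
     (nth [::] [:: [:: a; 0; d]; [:: 0; b; 0]; [:: c; 0; 0]] i)`_j) ->
  char_poly A = ('X - b%:P) * ('X^2 - a%:P * 'X - (c * d)%:P).
Proof.
move=> AE; rewrite /char_poly det_mx3 !mxE !AE.
rewrite -!val_eqE /= !inordK //= polyCM !polyC0.
ring.
Qed.

(** Row [i] is the differential applied to the [i]-th basis row, so the table is the transpose of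
    the usual Jacobian. *)
Lemma linearization_vector_field (R : realType) (eps xi wm lam0 : R)
    (z : R -> R) (i j : 'I_3) :
  z lam0 = 0 -> derivable z lam0 1 -> derivable (derive1 z) lam0 1 ->
  derive1 z lam0 != 0 ->
  linearization (vector_field eps xi wm z) (state 0 0 lam0) i j =
  (nth [::] [:: [:: - (3 / 2) * (1 - wm); 0; (derive1 z lam0)^-1];
      [:: 0; 3 / 2 * (1 + wm); 0];
      [:: - 3 * xi * (1 - 3 * wm) * derive1 z lam0; 0; 0]] i)`_j.
Proof.
move=> z0 dz dz' z'0.
have [_ dF] := is_diff_vector_field eps xi wm z0 dz dz' z'0.
rewrite /linearization /jacobian mxE dF mxE.
rewrite /xc /yc /lamc !mxE -!val_eqE /= !inordK //.
by case: i j => [[|[|[|//]]] lti] [[|[|[|//]]] ltj] /=;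
  rewrite ?(mulr0, mulr1, mul0r, mul1r, oppr0, addr0, subr0, sub0r, mulNr).
Qed.

Theorem mainTheorem4 (R : realType) (eps xi wm : R) (I : set R) (z : R -> R)
    (lam4 : R)
    (heps : eps = 1 \/ eps = - 1)
    (hI : open_interval I)
    (hz : smooth_on I z)
    (hz' : forall t : R, I t -> derive1 z t != 0)
    (hlam4 : I lam4)
    (hz0 : z lam4 = 0) :
  let F : 'rV[R]_3 -> 'rV[R]_3 := vector_field eps xi wm z in
  let p : 'rV[R]_3 := state 0 0 lam4 in
  let A : 'M[R]_3 := linearization F p in
  let s : R[i] :=
    sqrtC (((1 - wm) ^+ 2 - 16 / 3 * xi * (1 - 3 * wm))%:C : R[i]) in
  let l1 : R[i] := - (3 / 4) * ((1 - wm)%:C + s) in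
  let l2 : R[i] := (3 / 2 * (1 + wm))%:C in
  let l3 : R[i] := - (3 / 4) * ((1 - wm)%:C - s) in
  [/\ critical_point I F p,
      w_eff eps xi wm z p = wm,
      differentiable F p /\ eigenvalues_are A [:: l1; l2; l3],
      wm = - 1 -> l2 = 0 /\ degenerate A
    & wm = 1 / 3 -> l3 = 0 /\ degenerate A].
Proof.
move=> F p A s l1 l2 l3.
have [px py pl] : [/\ xc p = 0, yc p = 0 & lamc p = lam4] by exact: state_coords.
(* The iterated derivatives of orders 0 and 1 are [z] and [derive1 z] by conversion. *)
have dz : derivable z lam4 1 by exact: (hz 0%N).
have dz' : derivable (derive1 z) lam4 1 by exact: (hz 1%N).
have z'0 : derive1 z lam4 != 0 by exact: hz'.
have AE i j := linearization_vector_field eps xi wm i j hz0 dz dz' z'0.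
(* The determinant of the [x]-[lambda] block, after [z'] has cancelled against its inverse. *)
set K := 3 * xi * (1 - 3 * wm).
have chiA : char_poly A = ('X - (3 / 2 * (1 + wm))%:P) *
    ('X^2 + (3 / 2 * (1 - wm))%:P * 'X + K%:P).
  rewrite (char_poly_decoupled_mx3 AE) mulfK //.
  have -> : - 3 * xi * (1 - 3 * wm) = - K by rewrite /K; ring.
  by rewrite [- (3 / 2) * _]mulNr !polyCN mulNr !opprK.
(* The left-hand side is, up to sign, the value of the characteristic polynomial at 0. *)
have degA : 3 / 2 * (1 + wm) * K = 0 -> degenerate A.
  move=> prod0; rewrite /degenerate eigenvalue_root_char chiA /root !hornerE.
  apply/eqP; rewrite -[RHS]oppr0 -[in RHS]prod0; ring.
split.
- split; first by rewrite /phase_space /= pl.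
  apply/rowP => j; rewrite /F /vector_field px py pl /dx /dy /dlam hz0 !mxE.
  by case: j => [[|[|[|//]]] ltj] /=; ring.
- by rewrite /w_eff px py pl /Dfun hz0; field.
- split; first by have [] := is_diff_vector_field eps xi wm hz0 dz dz' z'0.
  (* By Vieta it suffices to match [l1 + l3] and [l1 * l3] with the quadratic factor. There [s]
     cancels or occurs squared, so the choice of square root is immaterial. *)
  have chiAC : char_poly (map_mx (real_complex R) A) =
      \prod_(l <- [:: l1; l2; l3]) ('X - l%:P).
    have sum13 : l1 + l3 = - (3 / 2 * (1 - wm))%:C.
      rewrite /l1 /l3 !(rmorphM, rmorphB, fmorphV, rmorph_nat, rmorph1) /=.
      by field.
    have prod13 : l1 * l3 = K%:C.
      have -> : l1 * l3 = 9 / 16 * ((1 - wm)%:C ^+ 2 - s ^+ 2).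
        by rewrite /l1 /l3; field.
      rewrite sqrtCK /K.
      rewrite !(rmorphM, rmorphB, rmorphXn, fmorphV, rmorph_nat, rmorph1) /=.
      by field.
    have fact (u v : R[i]) : ('X - u%:P) * ('X - v%:P) =
        'X^2 - (u + v)%:P * 'X + (u * v)%:P.
      by rewrite polyCD polyCM; ring.
    rewrite -map_char_poly /= chiA !big_cons big_nil mulr1 mulrCA fact.
    rewrite sum13 prod13 polyCN mulNr opprK.
    rewrite rmorphM rmorphB !rmorphD rmorphXn /= !map_polyC.
    by rewrite [map_poly _ (_ * 'X)]rmorphM /= map_polyC map_polyX.
  split=> // l.
  by rewrite eigenvalue_root_char chiAC root_prod_XsubC.
- by move=> wmE; split; [rewrite /l2|apply: degA]; rewrite wmE subrr mulr0 ?mul0r.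
- move=> wmE; split; last by apply: degA; rewrite /K wmE; field.
  have disc : (1 - wm) ^+ 2 - 16 / 3 * xi * (1 - 3 * wm) = (1 - wm) ^+ 2.
    by rewrite wmE; field.
  (* Here the branch matters: [sqrtC] undoes the square because [1 - wm = 2/3] is nonnegative, which
     makes [l3], and not [l1], vanish. *)
  have sE : s = (1 - wm)%:C.
    by rewrite /s disc rmorphXn sqrCK // ler0c wmE; lra.
  by rewrite /l3 sE subrr mulr0.
Qed.
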